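(* Let $s\ge 2$ be an integer and let $\Sigma\subset CAT(\Lambda_s^{\mathbb N})$ be an ID semigroup. Then $\langle\Sigma,\sigma^{-1}\rangle\subset CAT(\Lambda_s^{\mathbb Z})$ is an ID semigroup.
   Context: $\mathbb N$ includes $0$. $\Lambda_s=\{0,1,\dots,s-1\}$ is the symbol set (discrete topology); $\Lambda_s^{\mathbb N}$ and $\Lambda_s^{\mathbb Z}$ are the spaces of one-sided and two-sided sequences, with the product topology. On both, $\sigma$ is the left shift, $\sigma(a)_k=a_{k+1}$. For $\Omega=\Lambda_s^{\mathbb N}$ or $\Lambda_s^{\mathbb Z}$, $CAT(\Omega)$ is the semigroup (under composition) of all continuous maps $\tau:\Omega\to\Omega$ with $\tau\sigma=\sigma\tau$. Embedding of $CAT(\Lambda_s^{\mathbb N})$ in $CAT(\Lambda_s^{\mathbb Z})$: every $\tau\in CAT(\Lambda_s^{\mathbb N})$ is given by a block map $f_\tau:\Lambda_s^{r+1}\to\Lambda_s$ for some $r\in\mathbb N$, via $\tau(a)_k=f_\tau(a_k a_{k+1}\dots a_{k+r})$ for all $k$; the same formula for all $k\in\mathbb Z$ defines an element of $CAT(\Lambda_s^{\mathbb Z})$. Under this correspondence $CAT(\Lambda_s^{\mathbb N})$ is regarded as a subset of $CAT(\Lambda_s^{\mathbb Z})$, and a semigroup $\Sigma\subset CAT(\Lambda_s^{\mathbb N})$ as a semigroup in $CAT(\Lambda_s^{\mathbb Z})$. $\langle\Sigma,\tau\rangle$ denotes the semigroup generated under composition by $\tau$ and all elements of $\Sigma$.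 A semigroup $\Sigma\subset CAT(\Omega)$ is ID if every closed $\Sigma$-invariant proper subset of $\Omega$ is finite; a set $A$ is $\Sigma$-invariant if $\tau(A)\subset A$ for all $\tau\in\Sigma$. *)

(* Defs.v *)
From HB Require Import structures.
From mathcomp Require Import all_boot all_order all_algebra.
From mathcomp Require Import boolp classical_sets functions cardinality topology.

Set Implicit Arguments.
Unset Strict Implicit.
Unset Printing Implicit Defensive.

Import GRing.Theory.

Local Open Scope classical_set_scope.
Local Open Scope ring_scope.

Definition sequences (I : Type) (s : nat) : topologicalType :=
  {ptws I -> discrete_topology 'I_s}.

Definition one_sided (s : nat) : topologicalType := sequences nat s.
Definition two_sided (s : nat) : topologicalType := sequences int s.

Definition shiftN (s : nat) (a : one_sided s) : one_sided s :=
  fun k : nat => a k.+1.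

Definition shiftZ (s : nat) (a : two_sided s) : two_sided s :=
  fun k : int => a (k + 1).

Definition shiftZ_inv (s : nat) (a : two_sided s) : two_sided s :=
  fun k : int => a (k - 1).

Lemma shiftZK (s : nat) : cancel (@shiftZ s) (@shiftZ_inv s).
Proof. by move=> a; apply/funext => k; rewrite /shiftZ_inv /shiftZ subrK. Qed.

Lemma shiftZ_invK (s : nat) : cancel (@shiftZ_inv s) (@shiftZ s).
Proof. by move=> a; apply/funext => k; rewrite /shiftZ_inv /shiftZ addrK. Qed.

Definition CAT (X : topologicalType) (shift : X -> X) : set (X -> X) :=
  [set tau | continuous tau /\ tau \o shift = shift \o tau].

Definition comp_closed (T : Type) (S : set (T -> T)) : Prop :=
  forall f g, S f -> S g -> S (f \o g).

Definition semigroup_generated (T : Type) (G : set (T -> T)) : set (T -> T) :=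
  smallest (@comp_closed T) G.

Definition invariant_under (T : Type) (S : set (T -> T)) (A : set T) : Prop :=
  forall tau, S tau -> tau @` A `<=` A.

Definition ID (X : topologicalType) (S : set (X -> X)) : Prop :=
  forall A : set X,
    closed A -> invariant_under S A -> A `<` [set: X] -> finite_set A.

Definition ID_semigroup (X : topologicalType) (shift : X -> X)
    (S : set (X -> X)) : Prop :=
  [/\ S `<=` CAT shift, comp_closed S & ID S].

Definition block_codeN (s r : nat) (f : r.+1.-tuple 'I_s -> 'I_s)
    (a : one_sided s) : one_sided s :=
  fun k : nat => f [tuple (a (k + i)%N : 'I_s) | i < r.+1].

Definition block_codeZ (s r : nat) (f : r.+1.-tuple 'I_s -> 'I_s)
    (a : two_sided s) : two_sided s :=
  fun k : int => f [tuple (a (k + (i : nat)%:Z) : 'I_s) | i < r.+1].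

(* A map tau has many block maps, of various ranges r; two_sided_image_unique
   shows that they all give the same two-sided map, so this relation is the
   graph of the embedding of CAT (shiftN s) into CAT (shiftZ s). *)
Definition two_sided_image (s : nat) (tau : one_sided s -> one_sided s)
    (tau' : two_sided s -> two_sided s) : Prop :=
  exists (r : nat) (f : r.+1.-tuple 'I_s -> 'I_s),
    tau = block_codeN f /\ tau' = block_codeZ f.

Lemma two_sided_image_unique (s : nat) (tau : one_sided s -> one_sided s)
    (tau1 tau2 : two_sided s -> two_sided s) :
  two_sided_image tau tau1 -> two_sided_image tau tau2 -> tau1 = tau2.
Proof.
move=> [r1 [f1 [e1 ->]]] [r2 [f2 [e2 ->]]].
apply/funext => a; apply/funext => k.
exact: (congr1 (fun t : one_sided s -> one_sided s =>
  t (fun n : nat => a (k + n%:Z)) 0%N) (etrans (esym e1) e2)).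
Qed.

Definition embedZ (s : nat) (Sigma : set (one_sided s -> one_sided s)) :
    set (two_sided s -> two_sided s) :=
  [set tau' | exists2 tau, Sigma tau & two_sided_image tau tau'].

(* Main.v *)
(* Let A be closed and invariant under the generated semigroup.  For each j the
   set F_j of restrictions of points of A to the coordinates >= -j is a closed
   Sigma-invariant set of one-sided sequences, hence it is finite or full.  If
   every F_j is full then A is dense, hence not proper.  Otherwise some F_j is
   finite; invariance under the inverse shift makes F_j decrease with j, and
   finitely many points of A are separated by their restrictions for j large,
   so A has no more points than F_j. *)
Require Import Defs.
From mathcomp Require Import all_boot all_order all_algebra.
From mathcomp Require Import finmap zify.
From mathcomp Require Import boolp classical_sets functions cardinality topology.

Set Implicit Arguments.
Unset Strict Implicit.
Unset Printing Implicit Defensive.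

Import GRing.Theory.

Local Open Scope classical_set_scope.

(** Pigeonhole: among more points of [A] than [F] has elements, finitely many pairs must be told
    apart, so one level [J >= m] separates them all, while [f J] sends them into [F]. *)
Lemma finite_set_separating (T U : choiceType) (f : nat -> T -> U) (A : set T)
    (F : set U) :
  (forall j x y, f j.+1 x = f j.+1 y -> f j x = f j y) ->
  (forall x y, (forall j, f j x = f j y) -> x = y) ->
  finite_set F -> (exists m, forall j, (m <= j)%N -> f j @` A `<=` F) ->
  finite_set A.
Proof.
move=> fS fsep /finite_fsetP[X ->] [m fAF]; apply: contrapT => Ainf.
have [B BA cardB] := infinite_set_fset (#|` X|.+1) Ainf.
have flt j k x y : (j <= k)%N -> f k x = f k y -> f j x = f j y.
  by move=> /subnK <-; elim: (k - j)%N => [|n IH] //= /fS.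
(* [d (x, y)] is a level that separates [x] from [y] when they differ. *)
have /choice[d dP] : forall p : T * T, exists j : nat,
    f j p.1 = f j p.2 -> p.1 = p.2.
  move=> [x y] /=; apply: contrapT => /forallNP nj; apply: (nj 0%N) => _.
  by apply: fsep => j; apply: contrapT => ne; apply: (nj j).
pose J := (m + \max_(x <- B) \max_(y <- B) d (x, y))%N.
have finj : {in B &, injective (f J)}.
  move=> x y xB yB /flt fxy; apply: (dP (x, y)); apply: fxy => /=.
  apply: leq_trans (leq_addl _ _).
  apply: leq_trans (leq_bigmax_seq (F := fun y => d (x, y)) y yB isT) _.
  exact: (leq_bigmax_seq (F := fun x => \max_(y <- B) d (x, y)) x xB isT).
suff : (#|` B| <= #|` X|)%N by rewrite leqNgt cardB.
rewrite -(card_in_imfset imfset_key finj); apply: fsubset_leq_card.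
apply/fsubsetP => _ /imfsetP[x /= xB ->].
by apply: (fAF J (leq_addr _ _)); exists x => //; apply: BA.
Qed.

Section sequences.
Variables (I : eqType) (s : nat).

Lemma sequences_cvgP (F : set_system (sequences I s)) (x : sequences I s) :
  Filter F -> F --> x <-> forall i, F [set y | y i = x i].
Proof.
move=> FF; split=> [Fx i|Fx].
  apply: Fx; have := @proj_continuous I (fun=> discrete_topology 'I_s) i x.
  by move=> /(_ _ (discrete_set1 _)).
apply/cvg_sup => i U [_ [[B _ <-] Bx BU]].
by apply: filterS (Fx i) => y yx; apply: BU; rewrite /= yx.
Qed.

Lemma near_coord (x : sequences I s) i : \forall y \near x, y i = x i.
Proof. exact: (iffLR (sequences_cvgP x _)). Qed.

Lemma near_coords (J : finType) (h : J -> I) (x : sequences I s) :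
  \forall y \near x, forall j, y (h j) = x (h j).
Proof.
exact: (@filter_forall _ J (fun j y => y (h j) = x (h j)) (nbhs x) _
  (fun j => near_coord x (h j))).
Qed.

Lemma compact_sequences : compact [set: sequences I s].
Proof.
have := @tychonoff I (fun=> discrete_topology 'I_s) (fun=> setT)
  (fun=> @finite_compact (discrete_topology 'I_s) _
    (@finite_finset 'I_s setT)).
by congr (compact _); apply/seteqP; split.
Qed.

Lemma hausdorff_sequences : hausdorff_space (sequences I s).
Proof. by apply: hausdorff_product => i; exact: discrete_hausdorff. Qed.

Lemma continuous_to_sequences (T : topologicalType) (g : T -> sequences I s) :
  (forall x i, \forall y \near x, g y i = g x i) -> continuous g.
Proof. by move=> gP x; apply/sequences_cvgP => i; exact: gP. Qed.

End sequences.

(** Otherwise points outside [U] that agree with [x] on ever longer prefixes would converge to [x],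
    hence enter [U]. *)
Lemma nbhs_cylinder s (x : one_sided s) (U : set (one_sided s)) :
  nbhs x U ->
  exists n, forall y : one_sided s, (forall k, (k < n)%N -> y k = x k) -> U y.
Proof.
move=> xU; apply: contrapT => /forallNP nU.
have /choice[u uP] : forall n, exists y : one_sided s,
    (forall k, (k < n)%N -> y k = x k) /\ ~ U y.
  by move=> n; have /existsNP[y /not_implyP] := nU n; exists y.
have /(_ U xU)[N _ NU] : u @ \oo --> x.
  apply/sequences_cvgP => k; exists k.+1 => // n /= kn.
  by have [-> //] := uP n.
by have [_] := uP N; apply; apply: NU => /=.
Qed.

(* Curtis-Hedlund-Lyndon *)
Lemma CAT_block_codeN s (tau : one_sided s -> one_sided s) :
  CAT (@shiftN s) tau ->
  exists (r : nat) (f : r.+1.-tuple 'I_s -> 'I_s), tau = block_codeN f.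
Proof.
move=> [tauC tauS].
(* Continuity gives each point [x] a window length valid on a cylinder around [x]; compactness makes
   it uniform. *)
have [N _ NP] : \forall r \near \oo, [set: one_sided s] `<=`
    [set x | forall y, (forall k, (k < r)%N -> y k = x k) ->
       tau y 0%N = tau x 0%N].
  apply: (iffLR (compact_near_coveringP _) (@compact_sequences nat s)) => x _.
  have : nbhs x [set y | tau y 0%N = tau x 0%N].
    exact: (tauC x _ (near_coord (tau x) 0%N)).
  move=> /nbhs_cylinder[n nP].
  exists ([set y | forall k, (k < n)%N -> y k = x k], [set r | (n <= r)%N]).
    split; last by exists n.
    have := near_coords (fun k : 'I_n => nat_of_ord k) x.
    by apply: filterS => y yx k kn; exact: (yx (Ordinal kn)).
  move=> [x' r] [/= xx' nr] y yx'.
  rewrite (nP x') // nP // => k kn; rewrite yx' ?xx' //.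
  exact: leq_trans nr.
(* The word [t] is continued by copies of its first letter, a default available without assuming
   ['I_s] inhabited. By [NP] the letters after the first [N.+1] do not affect coordinate 0. *)
pose f (t : N.+1.-tuple 'I_s) : 'I_s := tau (fun k => nth (thead t) t k) 0%N.
exists N, f; apply/funext => a; apply/funext => k.
(* Commutation with the shift moves coordinate [k] to coordinate 0. *)
have tauk : forall k b, tau b k = tau (fun n => b (k + n)%N) 0%N.
  elim=> [b|k' IH b]; first by congr (tau _ _); apply/funext.
  transitivity (tau (shiftN b) k').
    exact: (esym (congr1 (fun g => g b k') tauS)).
  by rewrite IH; congr (tau _ _); apply/funext => n; rewrite /shiftN addSn.
rewrite tauk /block_codeN /f; apply: esym; apply: (NP N.+1) => //= n nN.
have := tnth_mktuple (fun i : 'I_N.+1 => a (k + i)%N) (Ordinal nN).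
by rewrite (tnth_nth (thead [tuple a (k + i)%N | i < N.+1])).
Qed.

Lemma CAT_comp_closed (X : topologicalType) (shift : X -> X) :
  comp_closed (CAT shift).
Proof.
move=> f g [fC fS] [gC gS]; split.
  by move=> x; apply: continuous_comp; [exact: gC|exact: fC].
by rewrite -compA gS compA fS compA.
Qed.

Lemma semigroup_generated_comp_closed (T : Type) (G : set (T -> T)) :
  comp_closed (semigroup_generated G).
Proof. by move=> f g Sf Sg M GM; apply: (proj1 GM); [exact: Sf|exact: Sg]. Qed.

Section two_sided.
Variable s : nat.

Lemma shiftZ_inv_CAT : CAT (@shiftZ s) (@shiftZ_inv s).
Proof.
split; last by apply/funext => a /=; rewrite shiftZK shiftZ_invK.
by apply: continuous_to_sequences => x i; exact: near_coord.
Qed.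

Lemma block_codeZ_CAT r (f : r.+1.-tuple 'I_s -> 'I_s) :
  CAT (@shiftZ s) (block_codeZ f).
Proof.
split.
  apply: continuous_to_sequences => x k.
  have := near_coords (fun i : 'I_r.+1 => (k + (i : nat)%:Z)%R) x.
  by apply: filterS => y yx; congr f; apply: eq_mktuple.
apply/funext => a; apply/funext => k; congr f; apply: eq_mktuple => i.
by rewrite /shiftZ addrAC.
Qed.

Definition right_tail (j : nat) (a : two_sided s) : one_sided s :=
  fun n : nat => a (n%:Z - j%:Z)%R.

Lemma right_tailS j a b :
  right_tail j.+1 a = right_tail j.+1 b -> right_tail j a = right_tail j b.
Proof.
move=> ab; apply/funext => n; have := congr1 (fun c : one_sided s => c n.+1) ab.
by rewrite /right_tail (_ : n.+1%:Z - j.+1%:Z = n%:Z - j%:Z)%R //; lia.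
Qed.

Lemma right_tail_coord j a b (k : int) :
  (`|k| <= j)%N -> right_tail j a = right_tail j b -> a k = b k.
Proof.
move=> kj /(congr1 (fun c : one_sided s => c (absz (k + j%:Z)%R))).
by rewrite /right_tail (_ : _ - _ = k)%R //; lia.
Qed.

Lemma right_tail_inj a b : (forall j, right_tail j a = right_tail j b) -> a = b.
Proof.
by move=> ab; apply/funext => k; exact: (right_tail_coord (leqnn _) (ab _)).
Qed.

Lemma right_tail_continuous j : continuous (right_tail j).
Proof. by apply: continuous_to_sequences => x i; exact: near_coord. Qed.

Lemma right_tail_shiftZ_inv j a :
  right_tail j (shiftZ_inv a) = right_tail j.+1 a.
Proof.
apply/funext => n; rewrite /right_tail /shiftZ_inv; congr a; lia.
Qed.

(** A block map reads only coordinates to the right, so it acts on tails; this carries invariance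
    from [A] to its image. *)
Lemma right_tail_block_code r (f : r.+1.-tuple 'I_s -> 'I_s) j a :
  right_tail j (block_codeZ f a) = block_codeN f (right_tail j a).
Proof.
apply/funext => n; congr f; apply: eq_mktuple => i.
by rewrite /right_tail; congr a; lia.
Qed.

(** Points of [A] sharing with [x] all coordinates from [-j] on converge to [x] as [j] grows. *)
Lemma closed_right_tail_full (A : set (two_sided s)) :
  closed A -> (forall j, right_tail j @` A = setT) -> A = setT.
Proof.
move=> Acl Afull; apply/seteqP; split=> // x _.
have /choice[u uP] : forall j, exists a, A a /\ right_tail j a = right_tail j x.
  move=> j; have : (right_tail j @` A) (right_tail j x) by rewrite Afull.
  by move=> [a Aa ax]; exists a.
apply: (@closed_cvg _ _ \oo _ u A Acl).
  by apply: nearW => j; have [] := uP j.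
apply/sequences_cvgP => k; exists `|k|%N => // j /= kj.
by have [_ /(right_tail_coord kj)] := uP j.
Qed.

End two_sided.

Theorem theorem4p1 (s : nat) (hs : (2 <= s)%N)
    (Sigma : set (one_sided s -> one_sided s)) :
  ID_semigroup (@shiftN s) Sigma ->
  ID_semigroup (@shiftZ s)
    (semigroup_generated (embedZ Sigma `|` [set @shiftZ_inv s])).
Proof.
move=> [SCAT Scomp SID]; split; last 1 first.
- move=> A Acl Ainv Aproper.
  have Ash a : A a -> A (shiftZ_inv a).
    move=> Aa; apply: (Ainv (@shiftZ_inv s)); last by exists a.
    by apply: sub_gen_smallest; right.
  have tail_fin j : right_tail j @` A = setT \/ finite_set (right_tail j @` A).
    have [|ne] := pselect (right_tail j @` A = setT); [by left|right].
    apply: SID; last by rewrite properEneq; split=> //; apply/eqP.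
      (* The image is closed as a continuous image of a compact set in a Hausdorff space. *)
      apply: compact_closed; first exact: hausdorff_sequences.
      apply: continuous_compact.
        by apply: continuous_subspaceT; exact: right_tail_continuous.
      exact: (subclosed_compact Acl (@compact_sequences int s)).
    move=> tau Stau _ [_ [a Aa <-] <-].
    have [r [f tauE]] := CAT_block_codeN (SCAT _ Stau).
    exists (block_codeZ f a); last by rewrite right_tail_block_code tauE.
    apply: (Ainv (block_codeZ f)); last by exists a.
    by apply: sub_gen_smallest; left; exists tau => //; exists r, f.
  have [m mfin] : exists m, finite_set (right_tail m @` A).
    apply: contrapT => /forallNP nfin.
    case: Aproper => _; apply; rewrite (closed_right_tail_full Acl) // => j.
    by case: (tail_fin j) => // /nfin.
  apply: (finite_set_separating (@right_tailS s) (@right_tail_inj s) mfin).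
  (* From level [m] on, every image lies in the finite one: a tail at level [i.+1 + m] of [a] is the
     tail at level [i + m] of [shiftZ_inv a]. *)
  exists m => j /subnK <-; elim: (j - m)%N => [//|i IH].
  apply: subset_trans IH => _ [a Aa <-].
  by exists (shiftZ_inv a); [exact: Ash|exact: right_tail_shiftZ_inv].
(* As [CAT] is closed under composition, only the generators need checking. *)
- apply: smallest_sub; first exact: CAT_comp_closed.
  move=> _ [[tau _ [r [f [_ ->]]]]|->]; first exact: block_codeZ_CAT.
  exact: shiftZ_inv_CAT.
- exact: semigroup_generated_comp_closed.
Qed.
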